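(* Let $(p_j)_{j\ge 1}$ satisfy $0\le p_j<1$ for all $j$, $0<p_1<1$, and $\sum_{k=1}^\infty (1-p_1)\cdots(1-p_k)<\infty$. In the random directed line graph on $\mathbb{Z}$ with connection probabilities $(p_j)$, let $T[0,n]$ be the maximum length of all paths from $0$ to $n$, and let $C$ be the deterministic constant with $L[0,n]/n\to C$ a.s. Then $T[0,n]/n\to C$ as $n\to\infty$, almost surely.
   Context: Random directed line graph: for each pair of integers $i<j$, independently over pairs, the directed edge $(i,j)$ is present with probability $p_{j-i}$. A path is an increasing sequence $i_0<i_1<\cdots<i_\ell$ of integers with every $(i_{s-1},i_s)$ an edge; its length is $\ell$; it is a path from $i_0$ to $i_\ell$. $T[i,j]$ is the maximum length of all paths from $i$ to $j$ (equal to $0$ if there is none). $L[i,j]$ is the maximum length of all paths with all vertices in $\{i,\ldots,j\}$ (equal to $0$ if there is no edge). By subadditivity there is a deterministic $C\in[0,1]$ with $L[0,n]/n\to C$ a.s. *)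

(* Defs.v *)
From HB Require Import structures.
From mathcomp Require Import all_boot all_order all_algebra.
From mathcomp Require Import zify.
From mathcomp Require Import all_classical all_reals all_analysis.
Set Implicit Arguments.
Unset Strict Implicit.
Unset Printing Implicit Defensive.
Import Order.TTheory GRing.Theory Num.Theory.
Import numFieldNormedType.Exports.

Local Open Scope classical_set_scope.
Local Open Scope ring_scope.

Section LinePaths.
Variable e : rel int.

(* The path is i :: s, so its length (number of edges) is size s.  Only the
   values of e on pairs a < b matter. *)
Definition line_path (i : int) (s : seq int) : bool :=
  path (fun a b => (a < b) && e a b) i s.

(* T[i,j].  Vertices increase, so every length is at most |j - i|: the bound
   on l excludes no path (see path_length_leq and path_length_attained).  The
   maximum over an empty range is 0. *)
Definition path_length (i j : int) : nat :=
  \max_(l < (absz (j - i)%R).+1 |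
        `[< exists s, [/\ line_path i s, last i s = j & size s = l] >]) l.

(* L[i,j].  Here too the bound on l excludes no path (see
   interval_path_length_leq and interval_path_length_attained). *)
Definition interval_path_length (i j : int) : nat :=
  \max_(l < (absz (j - i)%R).+1 |
        `[< exists a s, [/\ line_path a s,
                            all (fun k => i <= k <= j) (a :: s)
                          & size s = l] >]) l.

Lemma line_path_size (i : int) (s : seq int) :
  line_path i s -> i + (size s)%:Z <= last i s.
Proof.
elim: s i => [|b s IH] i /=; first by rewrite addr0.
rewrite /line_path /= => /andP[/andP[ib _] /IH]; lia.
Qed.

Lemma path_length_leq (i : int) (s : seq int) :
  line_path i s -> (size s <= path_length i (last i s))%N.
Proof.
move=> ps; have szs : (size s < (absz (last i s - i)%R).+1)%N.
  by have := line_path_size ps; lia.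
rewrite /path_length.
apply: (@leq_bigmax_cond _ _ (fun l : 'I__ => l : nat) (Ordinal szs)).
by apply/asboolP; exists s.
Qed.

Lemma path_length_attained (i j : int) :
  (exists2 s, line_path i s & last i s = j) ->
  exists s, [/\ line_path i s, last i s = j & size s = path_length i j].
Proof.
move=> [s ps sj]; have szs : (size s < (absz (j - i)%R).+1)%N.
  by have := line_path_size ps; lia.
pose Q : pred 'I_(absz (j - i)%R).+1 := fun l =>
  `[< exists s, [/\ line_path i s, last i s = j & size s = l] >].
have /(@eq_bigmax_cond _ Q (fun l => l : nat))[l Ql El] : (0 < #|Q|)%N.
  apply/card_gt0P; exists (Ordinal szs).
  by apply/asboolP; exists s.
by rewrite [path_length i j]El; move/asboolP: Ql.
Qed.

Lemma interval_path_length_leq (i j a : int) (s : seq int) :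
  line_path a s -> all (fun k => i <= k <= j) (a :: s) ->
  (size s <= interval_path_length i j)%N.
Proof.
move=> ps ij; have szs : (size s < (absz (j - i)%R).+1)%N.
  have := line_path_size ps.
  have /andP[ia _] : i <= a <= j by exact: (allP ij _ (mem_head _ _)).
  have /andP[_ lj] : i <= last a s <= j by exact: (allP ij _ (mem_last a s)).
  lia.
rewrite /interval_path_length.
apply: (@leq_bigmax_cond _ _ (fun l : 'I__ => l : nat) (Ordinal szs)).
by apply/asboolP; exists a, s.
Qed.

Lemma interval_path_length_attained (i j : int) : i <= j ->
  exists a s, [/\ line_path a s, all (fun k => i <= k <= j) (a :: s)
                & size s = interval_path_length i j].
Proof.
move=> ij.
pose Q : pred 'I_(absz (j - i)%R).+1 := fun l =>
  `[< exists a s, [/\ line_path a s, all (fun k => i <= k <= j) (a :: s)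
                    & size s = l] >].
have /(@eq_bigmax_cond _ Q (fun l => l : nat))[l Ql El] : (0 < #|Q|)%N.
  apply/card_gt0P; exists ord0.
  by apply/asboolP; exists i, [::]; split=> //=; rewrite lexx ij.
by rewrite [interval_path_length i j]El; move/asboolP: Ql.
Qed.

End LinePaths.

Section RandomGraph.
Context {d : measure_display} {Omega : measurableType d} {R : realType}.
Variable P : probability Omega R.

Definition mutually_independent (I : eqType) (D : set I)
    (A : I -> set Omega) : Prop :=
  forall s : seq I, uniq s -> [set` s] `<=` D ->
    P (\bigcap_(k in [set` s]) A k) = (\prod_(k <- s) P (A k))%E.

(* edge i j is the event that (i,j) is an edge; only pairs i < j are
   constrained, and only these are used by paths.  The value p 0 is unused. *)
Definition random_line_graph (p : nat -> R)
    (edge : int -> int -> set Omega) : Prop :=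
  [/\ forall i j, i < j -> measurable (edge i j),
      forall i j, i < j -> P (edge i j) = (p (absz (j - i)))%:E
    & mutually_independent [set ij : int * int | ij.1 < ij.2]
        (fun ij => edge ij.1 ij.2)].

End RandomGraph.

Section RandomLengths.
Context {Omega : Type}.
Variable edge : int -> int -> set Omega.

Definition edge_rel (w : Omega) : rel int := fun i j => w \in edge i j.

Definition T_length (i j : int) (w : Omega) : nat :=
  path_length (edge_rel w) i j.

Definition L_length (i j : int) (w : Omega) : nat :=
  interval_path_length (edge_rel w) i j.

End RandomLengths.

(* Main.v *)
(* Call v a skeleton point if every i < v has an edge into (i, v] and every
   j > v has an edge from [v, j): then every i < v is joined to v by a path and
   v to every j > v.  If u <= v <= n are skeleton points, a longest path of
   [0, n] is turned into a path from 0 to n at the cost of at most u + (n - v)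
   edges, so it is enough that the gaps between skeleton points are o(n).
   The summability of (1 - p_1)...(1 - p_k) gives 0 a positive probability of
   being a skeleton point; as the shift is mixing, there are infinitely many of
   them almost surely.  By stationarity the probabilities that v is a skeleton
   point with none in (v, v + m] have, by Kac's argument, a sum over m of at
   most 1.  The Borel-Cantelli lemma, applied to v in a residue class modulo
   q + 1 with m = v / (q + 1), then bounds the gap after v by v / (q + 1). *)
From HB Require Import structures.
Require Import Defs.
From mathcomp Require Import all_boot all_order all_algebra.
From mathcomp Require Import zify ring lra.
From mathcomp Require Import all_classical all_reals all_analysis.
(* Again, since all_analysis has another [line_path]. *)
Import Defs.
Set Implicit Arguments.
Unset Strict Implicit.
Unset Printing Implicit Defensive.
Import Order.TTheory GRing.Theory Num.Theory.
Import numFieldNormedType.Exports.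
Local Open Scope classical_set_scope.
Local Open Scope ring_scope.

(** * Skeleton points and path lengths *)

Definition skeleton (e : rel int) (v : int) : Prop :=
  (forall i, i < v -> exists2 j, i < j <= v & e i j) /\
  (forall j, v < j -> exists2 i, v <= i < j & e i j).

Definition reaches (e : rel int) (i j : int) : Prop :=
  exists2 s, line_path e i s & last i s = j.

Section Skeleton.
Variable e : rel int.

(** Each vertex below [v] has an edge that brings it closer to [v] without passing it, so following
    such edges ends at [v]; the induction is on the distance [v - i]. *)
Lemma reaches_skeleton i v : skeleton e v -> i <= v -> reaches e i v.
Proof.
move=> [B _]; have [n] := ubnP (absz (v - i)); elim: n i => // n IH i ni iv.
have [->|ne] := eqVneq i v; first by exists [::].
have [|j /andP[ij jv] eij] := B i; first by lia.
have [||s ps ls] := IH j; [lia|lia|].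
by exists (j :: s) => //=; rewrite /line_path /= ij eij.
Qed.

Lemma skeleton_reaches v j : skeleton e v -> v <= j -> reaches e v j.
Proof.
move=> [_ F]; have [n] := ubnP (absz (j - v)); elim: n j => // n IH j nj vj.
have [->|ne] := eqVneq j v; first by exists [::].
have [|i /andP[vi ij] eij] := F j; first by lia.
have [||s ps ls] := IH i; [lia|lia|].
exists (rcons s j); rewrite ?last_rcons // /line_path rcons_path.
by rewrite -/(line_path e v s) ps ls ij eij.
Qed.

Lemma reaches_trans i j k : reaches e i j -> reaches e j k -> reaches e i k.
Proof.
move=> [s ps <-] [t pt <-]; exists (s ++ t); last by rewrite last_cat.
by rewrite /line_path cat_path -/(line_path e i s) ps.
Qed.

(** The path is followed up to its last vertex at most [v] and then rerouted through [v] to [n]. *)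
Lemma line_path_extend_right a s (v n : int) :
  skeleton e v -> v <= n -> a <= v -> last a s <= n -> line_path e a s ->
  exists t, [/\ line_path e a t, last a t = n &
             (size s)%:Z <= (size t)%:Z + (n - v)].
Proof.
move=> Sv vn; have reach a' : a' <= v -> reaches e a' n.
  move=> av.
  exact: reaches_trans (reaches_skeleton Sv av) (skeleton_reaches Sv vn).
elim: s a => [|b s IH] a av /=.
  by move=> _ _; have [t pt lt] := reach a av; exists t; split=> //; lia.
move=> ln; rewrite {1}/line_path /= => /andP[/andP[ab eab] ps].
have [bv|vb] := leP b v.
  have [t [pt lt st]] := IH b bv ln ps.
  exists (b :: t); split=> //=; first by rewrite /line_path /= ab eab.
  by rewrite !intS -addrA lerD2l.
(* The path is cut at [a]: the edge to [b > v] and the edges after it number at most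
   [1 + (n - b) <= n - v]. *)
have [t pt lt] := reach a av; exists t; split=> //.
by have /= := line_path_size ps; lia.
Qed.

(** The first vertex of the path that is at least [v] is reached from 0 through [v], and the rest of
    the path is kept. The budget [m] pays for the dropped edges: each starts below [v] and advances
    by at least 1. *)
Lemma line_path_extend_left a s (v m : int) :
  skeleton e v -> 0 <= v -> 0 <= a -> v <= last a s -> line_path e a s ->
  0 <= m -> v - a <= m ->
  exists t, [/\ line_path e 0 t, last 0 t = last a s &
             (size s)%:Z <= (size t)%:Z + m].
Proof.
move=> Sv v0; elim: s a m => [|b s IH] a m a0 /= vl ps m0 vam.
  have [t pt lt] : reaches e 0 a.
    exact: reaches_trans (reaches_skeleton Sv v0) (skeleton_reaches Sv vl).
  by exists t; split=> //; lia.
have /andP[/andP[ab eab] pb] := ps.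
have [av|va] := ltP a v.
  have [|||t [pt lt st]] := IH b (m - 1) _ vl pb; [lia|lia|lia|].
  by exists t; split=> //; rewrite intS; lra.
have [t pt lt] : reaches e 0 a.
  exact: reaches_trans (reaches_skeleton Sv v0) (skeleton_reaches Sv va).
exists (t ++ b :: s); rewrite last_cat /= size_cat /=; split=> //; last by lia.
by rewrite /line_path cat_path -/(line_path e 0 t) pt lt.
Qed.

Lemma interval_path_length_le_skeleton (u v n : int) :
  skeleton e u -> skeleton e v -> 0 <= u <= v -> v <= n ->
  (interval_path_length e 0 n)%:Z <= (path_length e 0 n)%:Z + u + (n - v).
Proof.
move=> Su Sv uv vn.
have [|a [s [ps aln szs]]] := @interval_path_length_attained e 0 n; first by lia.
rewrite -szs.
have /andP[a0 an] : 0 <= a <= n by exact: (allP aln _ (mem_head _ _)).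
have /andP[_ ln] : 0 <= last a s <= n by exact: (allP aln _ (mem_last a s)).
(* If [a > v], the whole path lies in [(v, n]] and has fewer than [n - v] edges. Otherwise its right
   end is rerouted through [v], then its left end through [u]; as [a >= 0], the budget [u] suffices
   on the left. *)
have [av|va] := leP a v; last by have := line_path_size ps; lia.
have [t [pt lt st]] := line_path_extend_right Sv vn av ln ps.
have [||||||r [pr lr sr]] := @line_path_extend_left a t u u Su;
  [lia|lia| |done|lia|lia|].
  by rewrite lt; lia.
by have := path_length_leq pr; rewrite lr lt -lez_nat; lra.
Qed.

Lemma path_length_le_interval (i j : int) : i <= j ->
  (path_length e i j <= interval_path_length e i j)%N.
Proof.
move=> ij; apply/bigmax_leqP => l /asboolP[s [ps ls <-]].
apply: interval_path_length_leq (ps) _.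
suff h a : line_path e a s -> last a s = j -> i <= a ->
    all (fun k => i <= k <= j) (a :: s) by exact: h.
elim: s a {ps ls} => [|b s IH] a ps ls ia; first by rewrite /= -ls /= ia lexx.
have /andP[/andP[ab _] pb] := ps.
have aj : a <= j by have := line_path_size ps; rewrite ls /=; lia.
by apply/andP; split; [rewrite ia aj|apply: IH => //; exact: le_trans ia (ltW ab)].
Qed.

(** Induction on [n]: the current [v] is kept as long as [v + v %/ q] covers [n]; once it fails for
    [n.+1], the next skeleton point given by [gap] is already at most [n] and takes over. *)
Lemma skeleton_below (q N n : nat) :
  (forall v : nat, (N <= v)%N -> skeleton e v%:Z ->
     exists2 u : nat, (v < u <= v + v %/ q)%N & skeleton e u%:Z) ->
  skeleton e N%:Z -> (N <= n)%N ->
  exists2 v : nat, (N <= v <= n)%N && (n <= v + v %/ q)%N & skeleton e v%:Z.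
Proof.
move=> gap SN; elim: n => [|n IH] Nn.
  by exists N; rewrite // leqnn Nn.
have [Nn1|ne] := eqVneq N n.+1; first by exists N; rewrite // -Nn1 !leqnn leq_addr.
have [|v /andP[/andP[Nv vn] nv] Sv] := IH; first by lia.
have [nv1|nv1] := leqP n.+1 (v + v %/ q).
  by exists v; rewrite // nv1 Nv ltnW.
have [u /andP[vu uv] Su] := gap v Nv Sv.
have vqu : (v %/ q <= u %/ q)%N by apply: leq_div2r; exact: ltnW.
exists u => //; rewrite (leq_trans Nv (ltnW vu)) (leq_trans uv (ltnW nv1)) /=.
by rewrite (leq_ltn_trans nv) // -addSn leq_add.
Qed.

(** The deterministic part of the argument: for every [q] there is an [N] such that the two lengths
    differ by at most [N + n %/ q.+1] for all [n >= N]. *)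
Lemma path_length_cvg (R : realType) (C : R) :
  (forall k : nat, exists2 v : nat, (k <= v)%N & skeleton e v%:Z) ->
  (forall q : nat, exists N : nat, forall v : nat, (N <= v)%N ->
     skeleton e v%:Z ->
     exists2 u : nat, (v < u <= v + v %/ q.+1)%N & skeleton e u%:Z) ->
  (fun n : nat => (interval_path_length e 0 n%:Z)%:R / n%:R : R) @ \oo --> C ->
  (fun n : nat => (path_length e 0 n%:Z)%:R / n%:R : R) @ \oo --> C.
Proof.
move=> inf gap LC.
suff D0 : (fun n : nat => (interval_path_length e 0 n%:Z)%:R / n%:R
           - (path_length e 0 n%:Z)%:R / n%:R : R) @ \oo --> (0 : R).
  rewrite (_ : (fun n => _) = (fun n : nat =>
      (interval_path_length e 0 n%:Z)%:R / n%:R -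
      ((interval_path_length e 0 n%:Z)%:R / n%:R -
       (path_length e 0 n%:Z)%:R / n%:R))); last by apply/funext => n; lra.
  by rewrite -[C]subr0; apply: cvgB LC D0.
apply/cvgrPdist_le => eps eps0.
(* With this [q] the term [n %/ q.+1] costs at most half of [eps] after division by [n]; the other
   half absorbs [N / n] for large [n]. *)
pose q := Num.truncn (2 / eps).
have qeps : (q.+1%:R)^-1 <= eps / 2.
  have h : 2 / eps < q.+1%:R by exact: truncnS_gt (2 / eps).
  rewrite -[eps / 2]invrK lef_pV2 ?posrE ?invr_gt0 ?divr_gt0 ?ltr0n //.
  by rewrite invf_div ltW.
(* [N] is a skeleton point past the threshold of [gap]; it serves as the left skeleton point for
   every [n]. *)
have [N0 gapN] := gap q; have [N NN0 SN] := inf N0.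
have gapN' v : (N <= v)%N -> skeleton e v%:Z ->
    exists2 u : nat, (v < u <= v + v %/ q.+1)%N & skeleton e u%:Z.
  by move=> Nv; apply: gapN; lia.
near=> n.
have Nn : (N <= n)%N by near: n; exact: nbhs_infty_ge.
have n0 : (0 < n)%N by near: n; exact: nbhs_infty_gt.
have [v vn Sv] := skeleton_below gapN' SN Nn.
have NvZ : 0 <= N%:Z <= v%:Z by lia.
have vnZ : v%:Z <= n%:Z by lia.
have Lle := interval_path_length_le_skeleton SN Sv NvZ vnZ.
have Tle := @path_length_le_interval 0 n%:Z isT.
have n0R : (0 : R) < n%:R by rewrite ltr0n.
rewrite sub0r normrN -mulrBl ger0_norm; last first.
  by rewrite divr_ge0 ?subr_ge0 ?ler_nat.
rewrite ler_pdivrMr //.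
have Lle' : (interval_path_length e 0 n%:Z <=
    path_length e 0 n%:Z + N + n %/ q.+1)%N.
  have: (v %/ q.+1 <= n %/ q.+1)%N by apply: leq_div2r; lia.
  lia.
have h1 : (n %/ q.+1)%:R <= n%:R * (eps / 2) :> R.
  apply: le_trans (_ : n%:R / q.+1%:R <= _).
    by rewrite ler_pdivlMr ?ltr0n // -natrM ler_nat leq_divM.
  by rewrite ler_pM2l.
have h2 : N%:R <= n%:R * (eps / 2) :> R.
  rewrite -ler_pdivrMr ?divr_gt0 //; near: n; exact: nbhs_infty_ger.
have : (interval_path_length e 0 n%:Z)%:R <=
   (path_length e 0 n%:Z)%:R + N%:R + (n %/ q.+1)%:R :> R.
  by rewrite -!natrD ler_nat.
nra.
Unshelve. all: by end_near. Qed.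

End Skeleton.

(** * Independent coin tosses and mixing *)

(** The sets on which the convergence holds form a lambda-system. For an increasing union, the
    domination by [mu] makes the mass that [nu n] puts outside [F k] small uniformly in [n]. *)
Lemma cvg_measure_pi_system d (T : measurableType d) (R : realType)
    (G : set (set T)) (mu : probability T R)
    (nu : nat -> {measure set T -> \bar R})
    (c : R) :
  @measurable _ T = <<s G >> -> setI_closed G -> G setT ->
  (forall n A, measurable A -> (nu n A <= mu A)%E) ->
  (forall A, G A -> fine (nu n A) @[n --> \oo] --> c * fine (mu A)) ->
  forall A, measurable A -> fine (nu n A) @[n --> \oo] --> c * fine (mu A).
Proof.
move=> mG setIG GT nule nuG A mA.
have fin n B : measurable B -> nu n B \is a fin_num.
  move=> mB; rewrite ge0_fin_numE // (le_lt_trans (nule n B mB)) //.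
  by rewrite (le_lt_trans (probability_le1 mu mB)) ?ltry.
have nuD n B B' : measurable B -> measurable B' -> B' `<=` B ->
    fine (nu n (B `\` B')) = fine (nu n B) - fine (nu n B').
  move=> mB mB' B'B; rewrite measureD //; last by rewrite ltey_eq fin.
  by rewrite setIidr // fineB ?fin.
have muD B B' : measurable B -> measurable B' -> B' `<=` B ->
    fine (mu (B `\` B')) = fine (mu B) - fine (mu B').
  move=> mB mB' B'B; rewrite measureD //; last by rewrite ltey_eq fin_num_measure.
  by rewrite setIidr // fineB ?fin_num_measure.
pose H := [set B | measurable B /\ fine (nu n B) @[n --> \oo] --> c * fine (mu B)].
suff: <<s G >> `<=` H by rewrite mG in mA => /(_ _ mA)[].
apply: lambda_system_subset => //; last first.
  by move=> B GB; split; [rewrite mG; exact: sub_sigma_algebra|exact: nuG].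
split => //.
- by split=> //; exact: nuG.
- move=> B B' B'B [mB cB] [mB' cB']; split; first exact: measurableD.
  rewrite muD // mulrBr.
  have -> : (fun n => fine (nu n (B `\` B'))) =
            (fun n => fine (nu n B) - fine (nu n B')).
    by apply/funext => n; exact: nuD.
  exact: cvgB.
- move=> F ndF HF; have mF n : measurable (F n) by have [] := HF n.
  have mU : measurable (\bigcup_n F n) by exact: bigcupT_measurable.
  split=> //.
  apply/cvgrPdist_le => eps eps0.
  (* Three errors add up to [eps]: [eta] for the convergence on [F k], and, for the union outside
     [F k], [|c| * eta] under [mu] and [eta] under [nu n]. *)
  pose eta := eps / (2 + `|c|).
  have den : 0 < 2 + `|c| by rewrite ltr_pwDl.
  have eta0 : 0 < eta by rewrite divr_gt0.
  have : fine (mu (F k)) @[k --> \oo] --> fine (mu (\bigcup_n F n)).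
    apply: fine_cvg; rewrite fineK ?fin_num_measure //.
    exact: nondecreasing_cvg_mu.
  move=> /cvgrPdist_le /(_ _ eta0) [k _ /(_ k (leqnn k))].
  have FkU : F k `<=` \bigcup_n F n by exact: bigcup_sup.
  rewrite -muD // ger0_norm ?fine_ge0 // => muk.
  have [_ /cvgrPdist_le /(_ _ eta0) cvk] := HF k.
  near=> n.
  have h1 : `|c * fine (mu (F k)) - fine (nu n (F k))| <= eta.
    by near: n; exact: cvk.
  have h2 : fine (nu n (\bigcup_n F n `\` F k)) <= eta.
    apply: le_trans muk; apply: fine_le; rewrite ?fin ?fin_num_measure //;
      by [exact: measurableD|apply: nule; exact: measurableD].
  have h3 : 0 <= fine (nu n (\bigcup_n F n `\` F k)) by rewrite fine_ge0.
  have h4 : `|c| * fine (mu (\bigcup_n F n `\` F k)) <= `|c| * eta.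
    by rewrite ler_wpM2l.
  have h5 : 0 <= fine (mu (\bigcup_n F n `\` F k)) by rewrite fine_ge0.
  rewrite nuD // in h2 h3; rewrite muD // in h4 h5.
  have -> : eps = (1 + 1 + `|c|) * eta by rewrite mulrC divfK ?gt_eqF.
  set x := fine (mu _) in h4 h5 *; set y := fine (nu n (\bigcup_n _)) in h2 h3 *.
  rewrite (_ : c * x - y = (c * fine (mu (F k)) - fine (nu n (F k)))
      + (c * (x - fine (mu (F k))) + (fine (nu n (F k)) - y))); last by ring.
  apply: le_trans (ler_normD _ _) _; rewrite -addrA [leRHS]mulrDl mul1r lerD //.
  apply: le_trans (ler_normD _ _) _.
  rewrite normrM (ger0_norm h5) distrC (ger0_norm h3) mulrDl mul1r addrC.
  by rewrite lerD.
Unshelve. all: by end_near. Qed.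

Lemma exists_lt_of_series_lty (R : realType) (f : nat -> \bar R) (eps : R) :
  (forall k, 0 <= f k)%E -> (\sum_(0 <= k <oo) f k < +oo)%E -> 0 < eps ->
  exists m, (\sum_(m <= k <oo) f k < eps%:E)%E.
Proof.
move=> f0 foo eps0.
have t0 := nneseries_tail_cvg foo (fun k _ => f0 k).
have : \forall m \near \oo, (\sum_(m <= k <oo) f k < eps%:E)%E.
  have /t0 : nbhs 0%E [set y : \bar R | (y < eps%:E)%E].
    by apply: open_ereal_lt'; rewrite lte_fin.
  by [].
by case=> m _ /(_ m (leqnn m)); exists m.
Qed.

(** Only the outcome [true] is prescribed: such sets are closed under intersection and generate the
    product sigma-algebra, and their probabilities are what mutual independence of the edges
    provides. *)
Definition cylinder (I : Type) (s : seq I) : set (I -> bool) :=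
  [set c : I -> bool | all c s].

Definition coins (I : Type) := g_sigma_algebraType (range (@cylinder I)).

Section Coins.
Variable I : eqType.
Implicit Types (s t : seq I) (A B : set (coins I)).

Lemma cylinderI s t : cylinder s `&` cylinder t = cylinder (s ++ t).
Proof.
apply/seteqP; split=> c; rewrite /cylinder /= all_cat; first by case=> -> ->.
by move=> /andP.
Qed.

(** The law of the coins is specified on duplicate-free lists only; this reduces every cylinder to
    one of them. *)
Lemma cylinder_undup s : cylinder s = cylinder (undup s).
Proof. by apply/seteqP; split=> c; rewrite /cylinder /= -(eq_all_r (mem_undup s)). Qed.

Lemma cylinders_setI : setI_closed (range (@cylinder I)).
Proof. by move=> _ _ [s _ <-] [t _ <-]; exists (s ++ t); rewrite ?cylinderI. Qed.

Lemma cylinder_nil : cylinder [::] = [set: coins I].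
Proof. by apply/seteqP; split. Qed.

Lemma coins_measurableE : @measurable _ (coins I) = <<s range (@cylinder I) >>.
Proof. by []. Qed.

Lemma measurable_cylinder s : measurable (cylinder s : set (coins I)).
Proof. by apply: sub_sigma_algebra; exists s. Qed.

Lemma measurable_heads k : measurable ([set c : coins I | c k] : set (coins I)).
Proof.
suff -> : [set c : coins I | c k] = cylinder [:: k] by exact: measurable_cylinder.
by apply/seteqP; split=> c; rewrite /cylinder /= andbT.
Qed.

Definition reindex_coins (f : I -> I) (c : coins I) : coins I := c \o f.

Lemma reindex_cylinder f s : reindex_coins f @^-1` cylinder s = cylinder (map f s).
Proof. by apply/seteqP; split=> c; rewrite /cylinder /= all_map. Qed.

Lemma measurable_reindex f : measurable_fun setT (reindex_coins f).
Proof.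
apply: (@measurability _ _ (coins I) (coins I) setT (reindex_coins f)
  (range (@cylinder I)) coins_measurableE) => _ [_ [s _ <-] <-].
by rewrite setTI reindex_cylinder; exact: measurable_cylinder.
Qed.

HB.instance Definition _ f := isMeasurableFun.Build _ _ _ _
  (reindex_coins f) (measurable_reindex f).

Lemma measurable_reindex_preimage f A :
  measurable A -> measurable (reindex_coins f @^-1` A).
Proof. by move=> mA; rewrite -[X in measurable X]setTI; exact: measurable_reindex. Qed.

Lemma measurable_tails s : measurable [set c : coins I | all (fun k => ~~ c k) s].
Proof.
elim: s => [|k s IH]; first by rewrite (_ : mkset _ = setT) //; apply/seteqP; split.
rewrite (_ : mkset _ = ~` [set c : coins I | c k] `&`
    [set c : coins I | all (fun k => ~~ c k) s]).
  by apply: measurableI IH; apply: measurableC; exact: measurable_heads.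
by apply/seteqP; split=> c /=; [move/andP => [/negP]|move=> [/negP-> ->]].
Qed.

Variables (R : realType) (q : I -> R) (mu : probability (coins I) R).
Hypothesis mu_cylinder :
  forall s, uniq s -> mu (cylinder s) = (\prod_(k <- s) q k)%:E.

(** Induction on [t]: the event that coin [k] shows tails is the event without a condition on [k]
    minus the one where [k] shows heads, which has [k] moved to [s]. *)
Lemma mu_cylinder_tails s t : uniq (s ++ t) ->
  mu (cylinder s `&` [set c : coins I | all (fun k => ~~ c k) t]) =
  (\prod_(k <- s) q k * \prod_(k <- t) (1 - q k))%:E.
Proof.
elim: t s => [|k t IH] s.
  rewrite cats0 => us; rewrite big_nil mulr1 -mu_cylinder //; congr (mu _).
  by apply/seteqP; split=> c // [].
move=> ust.
have ukst : uniq ((k :: s) ++ t) by move: ust; rewrite -[k :: t]cat1s uniq_catCA.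
have ust' : uniq (s ++ t) by move: ukst => /= /andP[].
rewrite (_ : _ `&` _ = (cylinder s `&` [set c : coins I | all (fun k => ~~ c k) t]) `\`
    (cylinder (k :: s) `&` [set c : coins I | all (fun k => ~~ c k) t])); last first.
  apply/seteqP; split=> c; rewrite /cylinder /=.
    by move=> [cs /andP[ck ct]]; split=> // -[/andP[]]; rewrite (negbTE ck).
  move=> [[cs ct] h]; split=> //; rewrite ct andbT; apply/negP => ck; apply: h.
  by rewrite ck cs.
rewrite measureD; last 3 first.
- by apply: measurableI; [exact: measurable_cylinder|exact: measurable_tails].
- by apply: measurableI; [exact: measurable_cylinder|exact: measurable_tails].
- by rewrite -ge0_fin_numE ?fin_num_measure //; apply: measurableI;
  [exact: measurable_cylinder|exact: measurable_tails].
rewrite [X in (_ - mu X)%E]setIidr; last first.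
  by move=> c [/andP[_ cs] ct].
apply: etrans (congr2 (fun x y => x - y)%E (IH _ ust') (IH _ ukst)) _.
by rewrite -EFinB !big_cons; congr (_%:E); ring.
Qed.

Section Reindex.
Variable f : I -> I.
Hypotheses (f_inj : injective f) (qf : forall k, q (f k) = q k).

Lemma mu_reindex A : measurable A -> mu (reindex_coins f @^-1` A) = mu A.
Proof.
move=> mA.
pose mu' := distribution mu (reindex_coins f).
change (mu' A = mu A).
apply: (@measure_unique _ R (coins I) (range (@cylinder I)) (fun=> setT)
  coins_measurableE cylinders_setI _ _ mu' mu) => //.
- by move=> _; exists [::]; rewrite ?cylinder_nil.
- by rewrite bigcup_const.
- move=> _ [s _ <-].
  have mus : mu (reindex_coins f @^-1` cylinder (undup s)) =
      (\prod_(k <- undup s) q k)%:E.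
    rewrite reindex_cylinder mu_cylinder ?map_inj_uniq ?undup_uniq // big_map.
    by congr (_%:E); apply: eq_bigr.
  by rewrite cylinder_undup; exact: etrans mus (esym (mu_cylinder (undup_uniq s))).
- by move=> _; apply: le_lt_trans (probability_le1 _ _) _; rewrite ?ltry //=.
Qed.

End Reindex.

(** For two cylinders the identity is exact for large [n], since the two sets of coins become
    disjoint. It extends to all events by two passes through the pi-system, first in [B], then in
    [A]. *)
Lemma mu_reindex_mixing (f : nat -> I -> I) A B :
  (forall n, injective (f n)) -> (forall n k, q (f n k) = q k) ->
  (forall k l, \forall n \near \oo, f n k != l) ->
  measurable A -> measurable B ->
  fine (mu (A `&` reindex_coins (f n) @^-1` B)) @[n --> \oo] -->
  fine (mu A) * fine (mu B).
Proof.
move=> f_inj qf fE mA mB.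
have mr n D : measurable D -> measurable (reindex_coins (f n) @^-1` D).
  exact: measurable_reindex_preimage.
have mixC s t : uniq s -> uniq t ->
    fine (mu (cylinder s `&` reindex_coins (f n) @^-1` cylinder t)) @[n --> \oo]
      --> fine (mu (cylinder s)) * fine (mu (cylinder t)).
  move=> us ut; apply: cvg_near_cst.
  have : \forall n \near \oo, forall l k, l \in s -> k \in t -> f n k != l.
    elim: s {us} => [|l s IH]; first by apply: nearW.
    have : \forall n \near \oo, forall k, k \in t -> f n k != l.
      elim: t {ut IH} => [|k t IH]; first by apply: nearW.
      have := fE k l; apply: filterS2 IH => n ht hk k'.
      by rewrite inE => /predU1P[->|/ht].
    apply: filterS2 IH => n hs hl l' k'.
    by rewrite inE => /predU1P[->|ls]; [exact: hl|exact: hs].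
  apply: filterS => n disj.
  rewrite reindex_cylinder cylinderI !mu_cylinder //=; last first.
    rewrite cat_uniq us map_inj_uniq // ut andbT /=.
    apply/hasPn => _ /mapP[k kt ->] /=; apply/negP => ks.
    by have := disj _ _ ks kt; rewrite eqxx.
  by rewrite big_cat big_map; congr (_ * _); apply: eq_bigr.
(* First pass: the cylinder is fixed and [B] varies. The domination by [mu] holds because reindexing
   by [f n] preserves [mu]. *)
have mixB s : uniq s ->
    fine (mu (cylinder s `&` reindex_coins (f n) @^-1` B)) @[n --> \oo]
      --> fine (mu (cylinder s)) * fine (mu B).
  move=> us.
  pose pf n : {measure set (coins I) -> \bar R} :=
    pushforward (mrestr mu (measurable_cylinder s)) (reindex_coins (f n)).
  pose nu := pf (fun n => measurable_reindex (f n)).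
  have nuE D : (fun n => fine (mu (cylinder s `&` reindex_coins (f n) @^-1` D))) =
      (fun n => fine (nu n D)).
    by apply/funext => n; rewrite setIC.
  rewrite nuE.
  apply: (@cvg_measure_pi_system _ (coins I) R (range (@cylinder I)) mu nu
    _ coins_measurableE cylinders_setI) => //.
  - by exists [::]; rewrite ?cylinder_nil.
  - move=> n D mD; rewrite -[leRHS](mu_reindex (f_inj n) (qf n)) //.
    by apply: measureIl; [exact: mr|exact: measurable_cylinder].
  - move=> _ [t _ <-]; rewrite -nuE (cylinder_undup t).
    by apply: mixC; rewrite ?undup_uniq.
(* Second pass: [B] is fixed, [A] varies, and the constant in the limit is [mu B]. *)
pose nu n : {measure set (coins I) -> \bar R} := mrestr mu (mr n B mB).
rewrite mulrC.
apply: (@cvg_measure_pi_system _ (coins I) R (range (@cylinder I)) mu nu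
    (fine (mu B)) coins_measurableE cylinders_setI) => //.
- by exists [::]; rewrite ?cylinder_nil.
- by move=> n D mD; rewrite /nu /mrestr; apply: measureIl => //; exact: (mr n B mB).
- move=> _ [s _ <-]; rewrite (cylinder_undup s) mulrC; apply: mixB.
  exact: undup_uniq.
Qed.

End Coins.

(** * Skeleton points of the random graph *)

Section LineCoins.
Notation X := (coins (int * int)%type).

Definition shift_pair (v : int) (k : int * int) : int * int :=
  (k.1 + v, k.2 + v).

Definition skeleton_at (v : int) : set X :=
  [set c | skeleton (fun i j => c (i, j)) v].

(* Ordered so that the [l]-th pair has difference [l]. *)
Definition in_pairs (n : nat) : seq (int * int) :=
  [seq (n.+1%:Z - l%:Z, n.+1%:Z) | l <- iota 1 n.+1].

Definition out_pairs (n : nat) : seq (int * int) :=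
  [seq (- n.+1%:Z, l%:Z - n.+1%:Z) | l <- iota 1 n.+1].

Definition step_pairs (m : nat) : seq (int * int) :=
  [seq (l%:Z - m%:Z, l%:Z - m%:Z + 1) | l <- iota 0 (m + m)].

Lemma shift_pair_inj v : injective (shift_pair v).
Proof. by move=> [a b] [a' b'] [/addIr-> /addIr->]. Qed.

Lemma skeleton_at_shift (u v : int) :
  reindex_coins (shift_pair v) @^-1` skeleton_at u = skeleton_at (u + v).
Proof.
apply/seteqP; split=> c [B F]; split => [i iv|j vj].
- have [|j ij cij] := B (i - v); first by lia.
  exists (j + v); first by lia.
  by move: cij; rewrite /reindex_coins /shift_pair /= subrK.
- have [|i ij cij] := F (j - v); first by lia.
  exists (i + v); first by lia.
  by move: cij; rewrite /reindex_coins /shift_pair /= subrK.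
- have [|j ij cij] := B (i + v); first by lia.
  exists (j - v); first by lia.
  by rewrite /reindex_coins /shift_pair /= subrK.
- have [|i ij cij] := F (j + v); first by lia.
  exists (i - v); first by lia.
  by rewrite /reindex_coins /shift_pair /= subrK.
Qed.

(** Index [n] collects the conditions on the vertices [n + 1] and [- (n + 1)], each involving
    finitely many coins. This gives measurability and prepares the union bound. *)
Lemma skeleton_at0E : skeleton_at 0 =
  \bigcap_n ([set c : X | has c (in_pairs n)] `&` [set c : X | has c (out_pairs n)]).
Proof.
apply/seteqP; split=> c.
  move=> [B F] n _; split; apply/hasP.
    have [|i /andP[i0 ij] cij] := F n.+1%:Z; first by lia.
    exists (i, n.+1%:Z) => //; apply/mapP; exists (absz (n.+1%:Z - i)).
      by rewrite mem_iota; lia.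
    by congr (_, _); lia.
  have [|j /andP[ij j0] cij] := B (- n.+1%:Z); first by lia.
  exists (- n.+1%:Z, j) => //; apply/mapP; exists (absz (j + n.+1%:Z)).
    by rewrite mem_iota; lia.
  by congr (_, _); lia.
move=> h; split=> [i i0|j j0].
  have [_ /hasP[_ /mapP[l lm ->] cl]] := h (absz i).-1 I.
  have ei : - (absz i).-1.+1%:Z = i by lia.
  rewrite mem_iota in lm; rewrite ei in cl.
  by exists (l%:Z + i) => //; lia.
have [/hasP[_ /mapP[l lm ->] cl] _] := h (absz j).-1 I.
have ej : (absz j).-1.+1%:Z = j by lia.
rewrite mem_iota in lm; rewrite ej in cl.
by exists (j - l%:Z) => //; lia.
Qed.

Lemma measurable_has (s : seq (int * int)) : measurable [set c : X | has c s].
Proof.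
rewrite (_ : mkset _ = ~` [set c : X | all (fun k => ~~ c k) s]).
  by apply: measurableC; exact: measurable_tails.
apply/seteqP; split=> c /=; rewrite -[all _ s]negbK -has_predC.
  by move=> cs; apply/negP; rewrite negbK; apply: sub_has cs => k /= ->.
by move/negP; rewrite negbK; apply: sub_has => k /=; rewrite negbK.
Qed.

Lemma measurable_skeleton_at v : measurable (skeleton_at v).
Proof.
rewrite -[v]add0r -skeleton_at_shift; apply: measurable_reindex_preimage.
rewrite skeleton_at0E; apply: bigcapT_measurable => n.
by apply: measurableI; exact: measurable_has.
Qed.

Definition no_skeleton_from (v : int) : set X :=
  \bigcap_(u : nat) ~` skeleton_at (u%:Z + v).

Lemma measurable_no_skeleton_from v : measurable (no_skeleton_from v).
Proof.
by apply: bigcapT_measurable => u; apply: measurableC; exact: measurable_skeleton_at.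
Qed.

Definition skeleton_gap (m : nat) (v : int) : set X :=
  skeleton_at v `&` \bigcap_(u in `I_m) ~` skeleton_at (u.+1%:Z + v).

Lemma measurable_skeleton_gap m v : measurable (skeleton_gap m v).
Proof.
apply: measurableI; first exact: measurable_skeleton_at.
by apply: bigcap_measurableType => u _; apply: measurableC; exact: measurable_skeleton_at.
Qed.

Lemma skeleton_gap_shift m (u v : int) :
  reindex_coins (shift_pair v) @^-1` skeleton_gap m u = skeleton_gap m (u + v).
Proof.
rewrite /skeleton_gap preimage_setI skeleton_at_shift preimage_bigcap.
congr (_ `&` _); apply: eq_bigcapr => w _.
by rewrite -preimage_setC skeleton_at_shift addrA.
Qed.

Lemma no_skeleton_from_shift (u v : int) :
  reindex_coins (shift_pair v) @^-1` no_skeleton_from u = no_skeleton_from (u + v).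
Proof.
rewrite /no_skeleton_from preimage_bigcap; apply: eq_bigcapr => w _.
by rewrite -preimage_setC skeleton_at_shift addrA.
Qed.

(** The event of index [m] says that [- m] is the last skeleton point at or before 0, which
    determines [m]. *)
Lemma trivIset_skeleton_gap :
  trivIset setT (fun m : nat => skeleton_gap m (- m%:Z)).
Proof.
suff H m m' c : (m < m')%N -> skeleton_gap m (- m%:Z) c ->
    skeleton_gap m' (- m'%:Z) c -> False.
  move=> m m' _ _ [c [h h']]; have [mm|mm|//] := ltngtP m m'.
    by case: (H m m' c).
  by case: (H m' m c).
move=> mm [Sm _] [_ /(_ (m' - m).-1)]; apply=> /=; first by lia.
by rewrite (_ : _ + _ = - m%:Z) //; lia.
Qed.

(** * Positive density, recurrence and gaps of the skeleton points *)

Section Measure.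
Variables (R : realType) (p : nat -> R) (mu : probability X R).

(** All pairs of integers carry a coin; those that are not increasing show heads with probability
    0. *)
Definition pair_prob (k : int * int) : R :=
  if k.1 < k.2 then p (absz (k.2 - k.1)) else 0.

Hypothesis hp : forall j : nat, (1 <= j)%N -> 0 <= p j < 1.
Hypothesis hp1 : 0 < p 1%N.
Hypothesis hsum :
  (\sum_(1 <= k <oo) (\prod_(1 <= i < k.+1) (1 - p i))%:E < +oo)%E.
Hypothesis mu_cylinder :
  forall s, uniq s -> mu (cylinder s) = (\prod_(k <- s) pair_prob k)%:E.

Lemma pair_prob_shift v k : pair_prob (shift_pair v k) = pair_prob k.
Proof.
rewrite /pair_prob /shift_pair /= ltrD2r; case: ifP => // _.
by rewrite opprD addrACA subrr addr0.
Qed.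

Lemma mu_shift v (A : set X) : measurable A ->
  mu (reindex_coins (shift_pair v) @^-1` A) = mu A.
Proof.
exact: (mu_reindex mu_cylinder (@shift_pair_inj v) (pair_prob_shift v)).
Qed.

Lemma prod_in_pairs n :
  \prod_(k <- in_pairs n) (1 - pair_prob k) = \prod_(1 <= i < n.+2) (1 - p i).
Proof.
rewrite /in_pairs big_map /index_iota subn1 -[n.+2.-1]/n.+1; apply: eq_big_seq => l.
rewrite mem_iota => ln; rewrite /pair_prob /= ifT; last by lia.
by congr (1 - p _); lia.
Qed.

Lemma prod_out_pairs n :
  \prod_(k <- out_pairs n) (1 - pair_prob k) = \prod_(1 <= i < n.+2) (1 - p i).
Proof.
rewrite /out_pairs big_map /index_iota subn1 -[n.+2.-1]/n.+1; apply: eq_big_seq => l.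
rewrite mem_iota => ln; rewrite /pair_prob /= ifT; last by lia.
by congr (1 - p _); lia.
Qed.

Lemma prod_step_pairs m :
  \prod_(k <- step_pairs m) pair_prob k = p 1%N ^+ (m + m).
Proof.
rewrite /step_pairs big_map.
transitivity (\prod_(l <- iota 0 (m + m)) p 1%N).
  apply: eq_bigr => l _; rewrite /pair_prob /= ifT; last by lia.
  by congr (p _); lia.
by rewrite big_const_seq count_predT size_iota iter_mulr_1.
Qed.


(** The probability that a given vertex receives no edge from the [n] vertices before it; by
    symmetry, also that it sends none to the [n] vertices after it. *)
Let r (n : nat) : R := \prod_(1 <= i < n.+1) (1 - p i).

Let r_ge0 n : 0 <= r n.
Proof.
by rewrite /r big_nat; apply: prodr_ge0 => i /andP[i1 _]; have := hp i1; lra.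
Qed.

Let r_decr n : r n.+1 <= r n.
Proof.
rewrite /r big_nat_recr //= ler_piMr //; first exact: (r_ge0 n).
by have := @hp n.+1 isT; lra.
Qed.

Lemma uniq_step_pairs m : uniq (step_pairs m).
Proof. by rewrite map_inj_uniq ?iota_uniq // => a b [] /addIr; lia. Qed.

Lemma exists_tail_half :
  exists m, (\sum_(m <= n <oo) (r n)%:E < (2^-1)%:E)%E.
Proof.
have r0 k : (0 <= (r k)%:E)%E by rewrite lee_fin.
apply: (exists_lt_of_series_lty r0) => //.
(* The assumed series starts at 1; the term split off here is the finite [r 0]. *)
rewrite nneseries_recl //.
by rewrite lte_add_pinfty // ltry.
Qed.

Lemma step_no_pairs (m n : nat) (t : seq (int * int)) : uniq t ->
  (forall k, k \in step_pairs m -> k \notin t) ->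
  \prod_(k <- t) (1 - pair_prob k) = r n.+1 ->
  mu (cylinder (step_pairs m) `&` [set c : X | all (fun k => ~~ c k) t]) =
  (p 1%N ^+ (m + m) * r n.+1)%:E.
Proof.
move=> ut disj tr; rewrite (mu_cylinder_tails mu_cylinder) ?prod_step_pairs ?tr //.
rewrite cat_uniq ut andbT uniq_step_pairs /=.
by apply/hasPn => k kt; apply/negP => /disj; rewrite kt.
Qed.

(* On the event that all edges between neighbours in [- m, m] are present, 0 can
   only fail to be a skeleton point because of a vertex outside [- m, m], whose
   edges are independent of that event. *)
Lemma mu_skeleton_at0_gt0 : (0 < mu (skeleton_at 0))%E.
Proof.
have [m tail] := exists_tail_half.
pose a := p 1%N ^+ (m + m); have a0 : 0 < a by rewrite exprn_gt0.
pose E := cylinder (step_pairs m) : set X.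
have muE : mu E = a%:E by rewrite mu_cylinder ?uniq_step_pairs // prod_step_pairs.
have mE : measurable E by exact: measurable_cylinder.
pose no t := E `&` [set c : X | all (fun k => ~~ c k) t].
have mno t : measurable (no t) by apply: measurableI => //; exact: measurable_tails.
(* [F n] is the part of [E] where [n + 1] or [- (n + 1)] violates the skeleton condition at 0. *)
pose F n := no (in_pairs n) `|` no (out_pairs n).
have mF n : measurable (F n) by exact: measurableU.
have muF n : (m <= n)%N -> (mu (F n) <= (a *+ 2)%:E * (r n)%:E)%E.
  move=> mn; have : (mu (F n) <= mu (no (in_pairs n)) + mu (no (out_pairs n)))%E.
    exact: measureU2.
  have -> : mu (no (in_pairs n)) = (a * r n.+1)%:E.
    apply: step_no_pairs (prod_in_pairs n).
      by rewrite map_inj_uniq ?iota_uniq // => x y []; lia.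
    move=> _ /mapP[l lm ->]; apply/mapP => -[l' l'm [e1 e2]].
    by rewrite !mem_iota in lm l'm; lia.
  have -> : mu (no (out_pairs n)) = (a * r n.+1)%:E.
    apply: step_no_pairs (prod_out_pairs n).
      by rewrite map_inj_uniq ?iota_uniq // => x y []; lia.
    move=> _ /mapP[l lm ->]; apply/mapP => -[l' l'm [e1 e2]].
    by rewrite !mem_iota in lm l'm; lia.
  move=> /le_trans; apply; rewrite -EFinD -EFinM lee_fin.
  (* The bound [r n.+1] is relaxed to [r n], the term whose tail sum is controlled. *)
  rewrite -mulr2n -mulrnAl ler_wpM2l ?r_decr //.
  by rewrite mulrn_wge0 // ltW.
have mS := measurable_skeleton_at 0.
have EF : E `\` skeleton_at 0 `<=` \bigcup_(n in ~` `I_m) F n.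
  move=> c [Ec nS]; have : (~` skeleton_at 0) c by [].
  rewrite skeleton_at0E setC_bigcap => -[n _ nc].
  have nomem t : ~ has c t -> all (fun k => ~~ c k) t.
    by move=> /negP; rewrite -all_predC.
  have [nm|mn] := ltnP n m; last first.
    exists n; first by apply/negP; rewrite -leqNgt.
    have [h|/negP h] := boolP (has c (in_pairs n)); last first.
      by left; split => //; exact: nomem.
    by right; split => //; apply: nomem => h'; apply: nc.
  (* For [n < m] the edges [(n, n + 1)] and [(- (n + 1), - n)] are among those that [E] supplies. *)
  case: nc; split; apply/hasP.
    exists (n%:Z, n.+1%:Z).
      by apply/mapP; exists 1%N; rewrite ?mem_iota //; congr (_, _); lia.
    apply: (allP Ec); apply/mapP; exists (n + m)%N; first by rewrite mem_iota; lia.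
    by congr (_, _); lia.
  exists (- n.+1%:Z, - n%:Z).
    by apply/mapP; exists 1%N; rewrite ?mem_iota //; congr (_, _); lia.
  apply: (allP Ec); apply/mapP; exists (m - n.+1)%N; first by rewrite mem_iota; lia.
  by congr (_, _); lia.
(* If 0 were almost never a skeleton point, [E] would be covered up to a null set by the [F n] with
   [n >= m], whose total mass is less than [2 * a * 2^-1 = a], the mass of [E]. *)
rewrite lt0e measure_ge0 andbT; apply/eqP => S0.
have : (mu E <= \sum_(m <= n <oo) mu (F n))%E.
  have ES0 : mu (E `&` skeleton_at 0) = 0%E.
    by apply: subset_measure0 S0; [exact: measurableI|exact: mS|exact: subIsetr].
  have -> : mu E = (mu (E `\` skeleton_at 0) + mu (E `&` skeleton_at 0))%E.
    exact: measureDI.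
  rewrite ES0 adde0.
  by apply: measure_sigma_subadditive_tail => //; exact: measurableD.
apply/negP; rewrite -ltNge muE.
apply: (@le_lt_trans _ _ (\sum_(m <= n <oo) ((a *+ 2)%:E * (r n)%:E))%E).
  rewrite eseries_cond [leRHS]eseries_cond.
  by apply: lee_nneseries => // n; rewrite andbT => /muF.
rewrite nneseriesZl; last by move=> n _; rewrite lee_fin r_ge0.
apply: (@lt_le_trans _ _ ((a *+ 2)%:E * (2^-1)%:E)%E).
  by rewrite lte_pmul2l // lte_fin mulrn_wgt0.
by rewrite -EFinM lee_fin; lra.
Qed.

(** By stationarity [k] may be taken to be 0. The event excludes that [n] is a skeleton point, for
    every [n], so mixing gives 0 for the product of its probability with the positive probability of
    [skeleton_at 0]. *)
Lemma mu_no_skeleton_from (k : nat) : mu (no_skeleton_from k%:Z) = 0%E.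
Proof.
have m0 := measurable_no_skeleton_from 0.
have mS := measurable_skeleton_at 0.
rewrite -[k%:Z]add0r -no_skeleton_from_shift mu_shift //.
have fE (a b : int * int) : \forall n \near \oo, shift_pair (n : nat)%:Z a != b.
  near=> n.
  have : (absz (b.1 - a.1) < n)%N by near: n; exact: nbhs_infty_gt.
  by apply: contraTneq => <- /=; rewrite -leqNgt; lia.
have := @mu_reindex_mixing _ R pair_prob mu mu_cylinder
  (fun n => shift_pair n%:Z) _ _ (fun n => @shift_pair_inj _)
  (fun n => pair_prob_shift _) fE m0 mS.
rewrite (_ : (fun n => _) = (fun=> 0)); last first.
  apply/funext => n /=; rewrite skeleton_at_shift add0r.
  rewrite (_ : _ `&` _ = set0) ?measure0 //.
  by apply/seteqP; split=> // c [/(_ n I)]; rewrite addr0.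
move=> /(cvg_unique _ (cvg_cst 0)) => /(_ (@norm_hausdorff _ _)) /esym/eqP.
rewrite mulf_eq0 => /orP[]; rewrite fine_eq0 ?fin_num_measure // => /eqP //.
by move=> S0; have := mu_skeleton_at0_gt0; rewrite S0 ltxx.
Unshelve. all: by end_near. Qed.

(* Kac's argument: by stationarity each [v m] may be replaced by [- m], and the
   events [skeleton_gap m (- m)] are disjoint. *)
Lemma skeleton_gap_series (v : nat -> int) :
  (\sum_(0 <= m <oo) mu (skeleton_gap m (v m)) <= 1)%E.
Proof.
have mG m u : measurable (skeleton_gap m u) by exact: measurable_skeleton_gap.
rewrite (eq_eseriesr (g := fun m => mu (skeleton_gap m (- m%:Z)))).
  have <- : mu (\bigcup_m skeleton_gap m (- m%:Z)) =
      (\sum_(0 <= m <oo) mu (skeleton_gap m (- m%:Z)))%E.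
    apply: measure_semi_bigcup => //; first exact: trivIset_skeleton_gap.
    exact: bigcupT_measurable.
  by apply: probability_le1; exact: bigcupT_measurable.
move=> m _; rewrite -[v m]add0r -[- _]add0r -!skeleton_gap_shift.
by rewrite !mu_shift.
Qed.

Lemma ae_skeleton_unbounded :
  {ae mu, forall c, forall k : nat,
     exists2 v : nat, (k <= v)%N & skeleton_at v%:Z c}.
Proof.
apply: ae_foralln => k; exists (no_skeleton_from k%:Z); split.
- exact: measurable_no_skeleton_from.
- exact: mu_no_skeleton_from.
- move=> c nc u _ Su; apply: nc; exists (u + k)%N; first exact: leq_addl.
  by rewrite PoszD.
Qed.

Lemma ae_skeleton_gap :
  {ae mu, forall c, forall q : nat, exists N : nat, forall v : nat, (N <= v)%N ->
     skeleton_at v%:Z c ->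
     exists2 u : nat, (v < u <= v + v %/ q.+1)%N & skeleton_at u%:Z c}.
Proof.
apply: ae_foralln => q.
(* For [v = m * q.+1 + l] with [l <= q], the window length [m] equals [v %/ q.+1]. Within one
   residue class [l] each [m] occurs once, so the bound on the series applies. *)
pose F (l m : nat) := skeleton_gap m (m * q.+1 + l)%:Z.
have mF l m : measurable (F l m) by exact: measurable_skeleton_gap.
have F0 l : mu (lim_sup_set (F l)) = 0%E.
  apply: lim_sup_set_cvg0 => //; apply: le_lt_trans (skeleton_gap_series _) _.
  exact: ltry.
have : {ae mu, forall c, forall l, (~` lim_sup_set (F l)) c}.
  apply: ae_foralln => l; exists (lim_sup_set (F l)); split.
  - by apply: bigcap_measurableType => k _; apply: bigcup_measurable => j _; exact: mF.
  - exact: F0.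
  - by move=> c /contrapT.
apply: filterS => c nF.
have /choice[M HM] l : exists M, forall m, (M <= m)%N -> ~ F l m c.
  have := nF l; rewrite /lim_sup_set setC_bigcap => -[M _].
  by rewrite setC_bigcup => HM; exists M => m Mm; exact: HM.
(* Above this threshold [v %/ q.+1] is at least [M l] for all residues [l] at once. *)
exists ((\max_(l < q.+1) M l) * q.+1 + q.+1)%N => v Nv Sv.
have vE := divn_eq v q.+1.
have lq : (v %% q.+1 < q.+1)%N by rewrite ltn_pmod.
have Mv : (M (v %% q.+1) <= v %/ q.+1)%N.
  apply: (@leq_trans (\max_(l < q.+1) M l)).
    exact: (@leq_bigmax _ (fun l : 'I_q.+1 => M l) (Ordinal lq)).
  by rewrite leq_divRL //; apply: leq_trans Nv; exact: leq_addr.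
apply: contrapT => nu; apply: (HM _ _ Mv); rewrite /F -vE; split=> // u /= uv Su.
apply: nu; exists (u.+1 + v)%N; last by rewrite PoszD.
by rewrite addSn ltnS leq_addl /= -addSn addnC leq_add2l.
Qed.

End Measure.
End LineCoins.

(** * Transfer from coin tosses to the random graph *)

Section GraphCoins.
Context (R : realType) (d : measure_display) (Omega : measurableType d).
Variables (P : probability Omega R) (p : nat -> R).
Variable edge : int -> int -> set Omega.
Hypothesis hG : random_line_graph P p edge.

(** The test [k.1 < k.2] forces tails where [edge] is arbitrary, possibly not even measurable, in
    agreement with the value 0 of [pair_prob]. *)
Definition edge_coins (w : Omega) : coins (int * int)%type :=
  fun k => (k.1 < k.2) && (w \in edge k.1 k.2).

Lemma edge_coins_cylinder (s : seq (int * int)) :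
  edge_coins @^-1` cylinder s =
  if all (fun k => k.1 < k.2) s then \bigcap_(k in [set` s]) edge k.1 k.2
  else set0.
Proof.
case: ifPn => [/allP slt|/allPn[k ks kn]]; apply/seteqP; split=> w //.
- by move=> /allP ws k /= ks; have /andP[_ /set_mem] := ws k ks.
- by move=> ws; apply/allP => k ks; apply/andP; split; [exact: slt|apply/mem_set/ws].
- by move=> /allP /(_ k ks) /andP[kl]; rewrite kl in kn.
Qed.

Lemma measurable_edge_coins : measurable_fun setT edge_coins.
Proof.
have [edge_m _ _] := hG.
apply: (@measurability _ _ Omega (coins (int * int)%type) setT edge_coins
  (range (@cylinder _)) (@coins_measurableE _)) => _ [_ [s _ <-] <-].
rewrite setTI edge_coins_cylinder; case: ifPn => // /allP slt.
by apply: fin_bigcap_measurable => // k ks; apply: edge_m; exact: slt.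
Qed.

HB.instance Definition _ := isMeasurableFun.Build _ _ _ _
  edge_coins measurable_edge_coins.

Lemma distribution_edge_coins (s : seq (int * int)) : uniq s ->
  distribution P edge_coins (cylinder s) = (\prod_(k <- s) pair_prob p k)%:E.
Proof.
have [_ edge_p ind] := hG.
move=> us; rewrite /distribution /pushforward edge_coins_cylinder.
case: ifPn => [/allP slt|/allPn[k ks kn]]; last first.
  (* A pair that is not increasing makes the event empty and contributes a factor 0 to the
     product. *)
  rewrite measure0 (big_rem k) //= {1}/pair_prob (negbTE kn) mul0r //.
rewrite ind // -prodEFin big_seq [RHS]big_seq; apply: eq_bigr => k ks.
by rewrite edge_p ?/pair_prob slt.
Qed.

Lemma ae_edge_coins (Q : coins (int * int)%type -> Prop) :
  {ae distribution P edge_coins, forall c, Q c} ->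
  {ae P, forall w, Q (edge_coins w)}.
Proof.
move=> [N [mN N0 QN]]; exists (edge_coins @^-1` N); split => //.
  by rewrite -[X in measurable X]setTI; exact: measurable_edge_coins.
by move=> w Qw; exact: QN.
Qed.

Lemma ae_T_length_cvg (C : R) :
  (forall j : nat, (1 <= j)%N -> 0 <= p j < 1) -> 0 < p 1%N ->
  (\sum_(1 <= k <oo) (\prod_(1 <= i < k.+1) (1 - p i))%:E < +oo)%E ->
  {ae P, forall w,
    (fun n : nat => (L_length edge 0 n%:Z w)%:R / n%:R : R) @ \oo --> C} ->
  {ae P, forall w,
    (fun n : nat => (T_length edge 0 n%:Z w)%:R / n%:R : R) @ \oo --> C}.
Proof.
move=> hp hp1 hsum hC.
have inf := ae_edge_coins
  (ae_skeleton_unbounded hp hp1 hsum distribution_edge_coins).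
have gap := ae_edge_coins (ae_skeleton_gap distribution_edge_coins).
(* Being a skeleton point depends on increasing pairs only, where the coins and the edges agree. *)
have sk w v : skeleton_at v (edge_coins w) <-> skeleton (edge_rel edge w) v.
  rewrite /skeleton_at /skeleton /edge_coins /edge_rel /=; split=> -[B F]; split.
  - by move=> i iv; have [j ij /andP[_ e]] := B i iv; exists j.
  - by move=> j vj; have [i ij /andP[_ e]] := F j vj; exists i.
  - by move=> i iv; have [j ij e] := B i iv; exists j; rewrite ?e ?andbT //; lia.
  - by move=> j vj; have [i ij e] := F j vj; exists i; rewrite ?e ?andbT //; lia.
apply: filterS3 hC inf gap => w LC infw gapw.
apply: path_length_cvg LC.
  by move=> k; have [v kv /sk Sv] := infw k; exists v.
move=> q; have [N HN] := gapw q; exists N => v Nv /sk Sv.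
by have [u uv /sk Su] := HN v Nv Sv; exists u.
Qed.

End GraphCoins.

Theorem theorem3 (R : realType) (d : measure_display)
    (Omega : measurableType d) (P : probability Omega R)
    (p : nat -> R) (edge : int -> int -> set Omega) (C : R)
    (hp : forall j : nat, (1 <= j)%N -> 0 <= p j < 1)
    (hp1 : 0 < p 1%N < 1)
    (hsum : (\sum_(1 <= k <oo) (\prod_(1 <= i < k.+1) (1 - p i))%:E < +oo)%E)
    (hG : random_line_graph P p edge)
    (hC : {ae P, forall w,
      (fun n : nat => (L_length edge 0 n%:Z w)%:R / n%:R : R) @ \oo --> C}) :
  {ae P, forall w,
    (fun n : nat => (T_length edge 0 n%:Z w)%:R / n%:R : R) @ \oo --> C}.
Proof.
by case/andP: hp1 => hp1_gt0 _; exact: (ae_T_length_cvg hG).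
Qed.
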